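(* Let $n\ge3$ and let $E\subset\mathfrak D_n$ be a nonempty set of quasi-diagrams in $\mathfrak S_n$ that is closed under taking rotations and closed under taking Koszul dual. Then $n=4g$ for some integer $g$, and $E\subset\mathfrak M_{4g}$, where $\mathfrak M_{4g}$ is the set of maximal chord diagrams in $\mathfrak S_{4g}$.
   Context: $k$ is an algebraically closed field of characteristic $0$; all algebras are over $k$ and basic. In a quiver $Q$, an arrow $a$ has source $s(a)$ and target $t(a)$; a path $a_1a_2\cdots a_l$ is composed from left to right, i.e. $t(a_i)=s(a_{i+1})$. An algebra $A$ is locally gentle if $A\cong kQ/I$ where: (1) $Q$ is a finite quiver such that at each vertex at most two arrows end and at most two arrows start; (2) $I$ is generated by paths of length two; (3) for every arrow $a$ there is at most one arrow $b$ such that $ab$ is a path in $I$ and at most one arrow $c$ such that $ca$ is a path in $I$, and there is at most one arrow $b'$ such that $ab'$ is a path not in $I$ and at most one arrow $c'$ such that $c'a$ is a path not in $I$. A gentle algebra is a finite-dimensional locally gentle algebra. A (nonzero) path in $A=kQ/I$ is a path $p$ of $Q$ (possibly trivial) with $p\notin I$; it is maximal if $pa=ap=0$ in $A$ for every arrow $a$. In a gentle algebra every arrow lies in a unique maximal path. ''Gentle algebra with one maximal path'' means that $A$ has exactly one maximal path $p$. If $p$ has length $n-1$ and passes successively through the vertices $v_1,\dots,v_n$ of $Q$ (each vertex of $Q$ occurs at most twice in this list), the associated permutation $\alpha\in\mathfrak S_n$ is given by $\alpha(i)=j$ if there is $j\ne i$ with $v_j=v_i$, and $\alpha(i)=i$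 otherwise. This gives a bijection between isomorphism classes of gentle algebras with one maximal path and quasi-diagrams. Concretely, $A$ is the subalgebra of the path algebra of the linear quiver $1\to2\to\cdots\to n$ spanned by its radical and the elements $e_i+e_{\alpha(i)}$ ($\alpha(i)\neq i$) and $e_i$ ($\alpha(i)=i$), where $e_i$ is the idempotent at vertex $i$. A quasi-diagram is a permutation $\alpha\in\mathfrak S_n$ with $\alpha^2=\mathrm{id}$; $\mathfrak D_n$ is the set of quasi-diagrams in $\mathfrak S_n$. A chord diagram is a quasi-diagram without fixed points. Write $\zeta_n=(1\,2\cdots n)$; permutations are composed from right to left. A quasi-diagram $\alpha$ is maximal if $\zeta_n\alpha$ has only one orbit on $\{1,\dots,n\}$. Koszul dual: a locally gentle algebra $A=kQ/I$, graded by path length, is Koszul, and its Koszul dual (the Yoneda algebra $\operatorname{Ext}_A(A_0,A_0)$) is isomorphic to the locally gentle algebra $A^!=kQ^!/I^!$, where $Q^!$ is the opposite quiver of $Q$ and $I^!$ is generated by the opposites of the paths of length two in $Q$ that do not appear in $I$. For a quasi-diagram $\alpha$ with gentle algebra $A$, the Koszul dual quasi-diagram $\alpha^!$ exists if $A^!$ is again a gentle algebra with one maximal path; in that case $\alpha^!$ is the quasi-diagram associated to $A^!$. A subset $E\subset\mathfrak D_n$ is closed under taking rotations if $\zeta_n^l\alpha\zeta_n^{-l}\in E$ for all $\alpha\in E$ and $l\in\mathbb Z$. It is closed under taking Koszul dual if for every $\alpha\in E$ the Koszul dual quasi-diagram $\alpha^!$ exists and lies in $E$. *)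

(* Defs.v *)
From HB Require Import structures.
From mathcomp Require Import all_boot all_order all_fingroup all_algebra.
From mathcomp Require Import finmap monalg.

Set Implicit Arguments.
Unset Strict Implicit.
Unset Printing Implicit Defensive.

Import GRing.Theory.
Local Open Scope ring_scope.

Record quiver := Quiver {
  vertex : finType;
  arrow : finType;
  source : arrow -> vertex;
  target : arrow -> vertex
}.

Section Paths.
Context (Q : quiver).
Implicit Types (v : vertex Q) (a : arrow Q) (s t : seq (arrow Q)).

Fixpoint walk v s : bool :=
  if s is a :: s' then (source a == v) && walk (target a) s' else true.

(* A path is a starting vertex with a composable list of arrows; the starting
   vertex distinguishes the trivial paths. *)
Record qpath := QPath {
  pval : vertex Q * seq (arrow Q);
  _ : walk pval.1 pval.2
}.
HB.instance Definition _ := [isSub for pval].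
HB.instance Definition _ := [Choice of qpath by <:].

Definition psource (p : qpath) : vertex Q := (pval p).1.
Definition parrows (p : qpath) : seq (arrow Q) := (pval p).2.
Definition vertices (p : qpath) : seq (vertex Q) :=
  psource p :: [seq target a | a <- parrows p].
Definition ptarget (p : qpath) : vertex Q := last (psource p) (vertices p).

Definition trivial_path v : qpath := @QPath (v, [::]) (erefl true).

Lemma walk_arrow a : walk (source a) [:: a].
Proof. by rewrite /= eqxx. Qed.

Definition arrow_path a : qpath := @QPath (source a, [:: a]) (walk_arrow a).

(* Paths compose from left to right; [None] when the endpoints do not match. *)
Definition pcomp (p q : qpath) : option qpath :=
  if ptarget p == psource q then insub (psource p, parrows p ++ parrows q)
  else None.

Lemma ptargetE (p : qpath) :
  ptarget p = last (psource p) [seq target a | a <- parrows p].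
Proof. by []. Qed.

Lemma walk_cat v s t :
  walk v (s ++ t) = walk v s && walk (last v [seq target a | a <- s]) t.
Proof. by elim: s v => //= a s IHs v; rewrite IHs andbA. Qed.

Lemma pcompP (p q : qpath) : ptarget p = psource q ->
  {r | pcomp p q = Some r & val r = (psource p, parrows p ++ parrows q)}.
Proof.
move=> pq; rewrite /pcomp pq eqxx.
case: insubP => [r _ rE | ]; first by exists r.
by rewrite /= walk_cat -ptargetE pq (valP p) (valP q).
Qed.

Lemma pcompN (p q : qpath) : ptarget p != psource q -> pcomp p q = None.
Proof. by rewrite /pcomp => /negPf->. Qed.

Lemma pcompA (p q r : qpath) :
  obind (fun x => pcomp x r) (pcomp p q) = obind (pcomp p) (pcomp q r).
Proof.
have [pq | npq] := eqVneq (ptarget p) (psource q); last first.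
  rewrite (pcompN npq) /=.
  have [qr | nqr] := eqVneq (ptarget q) (psource r); last by rewrite pcompN.
  have [x -> xE] := pcompP qr; rewrite /= pcompN //.
  by rewrite /psource xE.
have [x -> xE] := pcompP pq => /=.
have xt : ptarget x = ptarget q.
  by rewrite !ptargetE /psource /parrows xE /= map_cat last_cat -ptargetE pq.
have [qr | nqr] := eqVneq (ptarget q) (psource r); last first.
  by rewrite !pcompN // xt.
have [y -> yE] := pcompP qr => /=.
have xr : ptarget x = psource r by rewrite xt.
have py : ptarget p = psource y by rewrite /psource yE.
have [z -> zE] := pcompP xr; have [w -> wE] := pcompP py.
congr Some; apply: val_inj; rewrite zE wE /psource /parrows xE yE /=.
by rewrite catA.
Qed.

Lemma pcomp1p v (p : qpath) :
  pcomp (trivial_path v) p = if v == psource p then Some p else None.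
Proof.
case: eqP => [vp | /eqP vp]; last by rewrite pcompN.
have [x -> xE] := @pcompP (trivial_path v) p vp.
congr Some; apply: val_inj.
by rewrite xE {1}/psource /= vp [RHS]surjective_pairing.
Qed.

Lemma pcompp1 v (p : qpath) :
  pcomp p (trivial_path v) = if ptarget p == v then Some p else None.
Proof.
case: eqP => [vp | /eqP vp]; last by rewrite pcompN.
have [x -> xE] := @pcompP p (trivial_path v) vp.
by congr Some; apply: val_inj; rewrite xE /= cats0 [RHS]surjective_pairing.
Qed.

End Paths.

Section PathAlgebra.
Context (k : fieldType) (Q : quiver).

Definition path_algebra := {malg k[qpath Q]}.
HB.instance Definition _ := GRing.Lmodule.on path_algebra.

Implicit Types (x y z : path_algebra) (p q : qpath Q).

Definition pbasis p : path_algebra := << p >>.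

Definition lext (f : qpath Q -> path_algebra) x : path_algebra :=
  \sum_(p <- msupp x) x@_p *: f p.

Definition pmul p q : path_algebra := oapp pbasis 0 (pcomp p q).
Definition pamul x y : path_algebra := lext (fun p => lext (pmul p) y) x.
Definition paone : path_algebra := \sum_(v : vertex Q) pbasis (trivial_path v).

Lemma lextE f x (d : {fset qpath Q}) : (msupp x `<=` d)%fset ->
  lext f x = \sum_(p <- d) x@_p *: f p.
Proof.
move=> xd; rewrite /lext; apply/big_fset_incl => // p _ px.
by rewrite mcoeff_outdom // scale0r.
Qed.

Lemma lext_is_linear f : linear (lext f).
Proof.
move=> c x y; pose d := (msupp (c *: x + y) `|` (msupp x `|` msupp y))%fset.
rewrite !(@lextE _ _ d) ?fsubsetUl //; first last.
- by apply/fsubsetP=> p px; rewrite !inE px !orbT.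
- by apply/fsubsetP=> p px; rewrite !inE px !orbT.
rewrite scaler_sumr -big_split /=; apply: eq_bigr => p _.
by rewrite mcoeffD mcoeffZ scalerDl scalerA.
Qed.

HB.instance Definition _ f :=
  GRing.isLinear.Build k path_algebra path_algebra _ (lext f) (lext_is_linear f).

Lemma lext_basis f p : lext f (pbasis p) = f p.
Proof.
rewrite (@lextE _ _ [fset p]%fset) ?msuppU_le //.
by rewrite big_seq_fset1 mcoeffUU scale1r.
Qed.

Lemma path_algebraE x : x = \sum_(p <- msupp x) x@_p *: pbasis p.
Proof.
rewrite {1}(monalgE x); apply: eq_bigr => p _; apply/malgP => q.
by rewrite mcoeffZ !mcoeffU mulrnAr mulr1.
Qed.

Lemma eq_linear_basis (f g : {linear path_algebra -> path_algebra}) :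
  (forall p, f (pbasis p) = g (pbasis p)) -> f =1 g.
Proof.
move=> fg x; rewrite (path_algebraE x) !linear_sum; apply: eq_bigr => p _.
by rewrite !linearZ /= fg.
Qed.

Lemma pamul_basisl p y : pamul (pbasis p) y = lext (pmul p) y.
Proof. exact: lext_basis. Qed.

Lemma pamul_basis p q : pamul (pbasis p) (pbasis q) = pmul p q.
Proof. by rewrite pamul_basisl lext_basis. Qed.

Lemma pamul_linearl y : linear (pamul^~ y).
Proof. by move=> c x x'; rewrite /pamul linearP. Qed.

Lemma pamul_linearr x : linear (pamul x).
Proof.
move=> c y y'; rewrite /pamul /lext scaler_sumr -big_split /=.
apply: eq_bigr => p _; rewrite -/(lext _ _) linearP.
by rewrite scalerDr !scalerA mulrC.
Qed.

HB.instance Definition _ x := GRing.isLinear.Build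
  k path_algebra path_algebra _ (pamul x) (pamul_linearr x).

Definition pamulr y x := pamul x y.
HB.instance Definition _ y := GRing.isLinear.Build
  k path_algebra path_algebra _ (pamulr y) (pamul_linearl y).

Lemma pamulA : associative pamul.
Proof.
move=> x y z.
apply: (eq_linear_basis (f := pamulr (pamul y z))
                        (g := pamulr z \o pamulr y)) => p /=.
rewrite /pamulr.
apply: (eq_linear_basis (f := pamul (pbasis p) \o pamulr z)
                        (g := pamulr z \o pamul (pbasis p))) => q /=.
rewrite /pamulr.
apply: (eq_linear_basis (f := pamul (pbasis p) \o pamul (pbasis q))
                        (g := pamul (pamul (pbasis p) (pbasis q)))) => r /=.
rewrite !pamul_basis /pmul; have := pcompA p q r.
case: (pcomp p q) (pcomp q r) => [u|] [v|] /=.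
- by rewrite !pamul_basis /pmul => ->.
- by rewrite pamul_basis /pmul linear0 => ->.
- by rewrite pamul_basis /pmul -/(pamulr _ 0) linear0 => <-.
- by rewrite -/(pamulr _ 0) !linear0.
Qed.

Lemma pamul1l : left_id paone pamul.
Proof.
move=> x; apply: (eq_linear_basis (f := pamul paone) (g := idfun)) => p /=.
rewrite -/(pamulr _ _) linear_sum /= (bigD1 (psource p)) //= big1 => [|v].
  by rewrite /pamulr pamul_basis /pmul pcomp1p eqxx addr0.
by move=> /negPf vp; rewrite /pamulr pamul_basis /pmul pcomp1p vp.
Qed.

Lemma pamul1r : right_id paone pamul.
Proof.
move=> x; apply: (eq_linear_basis (f := pamulr paone) (g := idfun)) => p /=.
rewrite /pamulr linear_sum /= (bigD1 (ptarget p)) //= big1 => [|v].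
  by rewrite pamul_basis /pmul pcompp1 eqxx addr0.
by move=> vp; rewrite pamul_basis /pmul pcompp1 eq_sym (negPf vp).
Qed.

Lemma pamulDl : left_distributive pamul +%R.
Proof. by move=> x y z; rewrite -!/(pamulr z _) linearD. Qed.

Lemma pamulDr : right_distributive pamul +%R.
Proof. by move=> x y z; rewrite linearD. Qed.

HB.instance Definition _ := GRing.Zmodule_isPzRing.Build path_algebra
  pamulA pamul1l pamul1r pamulDl pamulDr.

(* No [algType] instance: it would require kQ to be nonzero, which fails for
   the empty quiver. *)
Lemma pascaleAl (c : k) x y : c *: (x * y) = (c *: x) * y.
Proof. by rewrite -[RHS]/(pamulr y (c *: x)) linearZ. Qed.

Lemma pascaleAr (c : k) x y : c *: (x * y) = x * (c *: y).
Proof. by rewrite -[RHS]/(pamul x (c *: y)) linearZ. Qed.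

End PathAlgebra.

(* A quiver with a set of paths of length two: [zero_rel a b] means that the
   path ab is one of the chosen generators of the ideal I. *)
Record bound_quiver := BoundQuiver {
  bquiver :> quiver;
  zero_rel : rel (arrow bquiver);
  zero_rel_comp : forall a b, zero_rel a b -> target a = source b
}.

Section BoundQuivers.
Context (k : fieldType) (B : bound_quiver).
Local Notation kQ := (path_algebra k B).
Implicit Types (a b c : arrow B) (p q : qpath B).

Definition two_sided_ideal (J : kQ -> Prop) : Prop :=
  [/\ J 0, forall x y, J x -> J y -> J (x + y) &
      forall u x v, J x -> J (u * x * v)].

Definition rel_ideal (x : kQ) : Prop :=
  forall J : kQ -> Prop, two_sided_ideal J ->
    (forall a b, zero_rel a b ->
       J (pbasis k (arrow_path a) * pbasis k (arrow_path b))) -> J x.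

Definition nonzero_walk (s : seq (arrow B)) : bool :=
  sorted (fun a b => ~~ zero_rel a b) s.

Lemma pmul_coef p q r : (pmul k p q)@_r != 0 ->
  ptarget p = psource q /\ parrows r = parrows p ++ parrows q.
Proof.
rewrite /pmul; have [pq | npq] := eqVneq (ptarget p) (psource q).
  have [x -> xE] := pcompP pq; rewrite /= mcoeffU.
  have [<- _ | _] := eqVneq x r; last by rewrite mulr0n eqxx.
  by rewrite {1}/parrows xE.
by rewrite pcompN //= mcoeff0 eqxx.
Qed.

Lemma mul_coef0 (x y : kQ) r :
  (forall p q, parrows r = parrows p ++ parrows q -> x@_p * y@_q = 0) ->
  (x * y)@_r = 0.
Proof.
move=> xy0; rewrite -[x * y]/(pamul x y) /pamul /lext raddf_sum /=.
rewrite big1 // => p _; rewrite mcoeffZ raddf_sum /= mulr_sumr big1 // => q _.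
rewrite mcoeffZ; have [-> | /pmul_coef[_ rE]] := eqVneq (pmul k p q)@_r 0.
  by rewrite !mulr0.
by rewrite mulrA xy0 // mul0r.
Qed.

Lemma rel_ideal_coef0 (x : kQ) p :
  rel_ideal x -> nonzero_walk (parrows p) -> x@_p = 0.
Proof.
move=> Ix; move: p.
pose J (z : kQ) := forall p, nonzero_walk (parrows p) -> z@_p = 0.
apply: (Ix J) => [|a b ab p gp].
  split=> [p _ | x' y Jx Jy p gp | u x' v Jx p gp]; first exact: mcoeff0.
    by rewrite mcoeffD Jx // Jy // addr0.
  apply: mul_coef0 => q r pE; rewrite mul_coef0 ?mul0r // => q1 q2 qE.
  rewrite [x'@_q2]Jx ?mulr0 //; move: gp.
  rewrite /nonzero_walk pE qE -catA => /cat_sorted2[_].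
  by case/cat_sorted2.
rewrite -[_ * _]/(pamul _ _) pamul_basis; apply/eqP/contraT => /pmul_coef[_ pE].
by move: gp; rewrite pE /nonzero_walk /= ab.
Qed.

(* A path of length two lies in I exactly when it is one of the generators. *)
Lemma rel_ideal_path2 a b : target a = source b ->
  rel_ideal (pbasis k (arrow_path a) * pbasis k (arrow_path b)) <-> zero_rel a b.
Proof.
move=> ab; split=> [Iab | zab J _]; last exact.
apply: contraT => nzab.
have [p pE rE] := @pcompP B (arrow_path a) (arrow_path b) ab.
have gp : nonzero_walk (parrows p).
  by rewrite /nonzero_walk /parrows rE /= nzab.
have := rel_ideal_coef0 Iab gp.
rewrite -[_ * _]/(pamul _ _) pamul_basis /pmul pE /= mcoeffUU => /eqP.
by rewrite oner_eq0.
Qed.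

Definition locally_gentle : Prop :=
  let in_I a b := target a = source b /\
    rel_ideal (pbasis k (arrow_path a) * pbasis k (arrow_path b)) in
  let notin_I a b := target a = source b /\
    ~ rel_ideal (pbasis k (arrow_path a) * pbasis k (arrow_path b)) in
  [/\ forall v : vertex B, (#|[set a | target a == v]| <= 2)%N /\
                           (#|[set a | source a == v]| <= 2)%N,
      forall a b b', in_I a b -> in_I a b' -> b = b',
      forall a c c', in_I c a -> in_I c' a -> c = c',
      forall a b b', notin_I a b -> notin_I a b' -> b = b' &
      forall a c c', notin_I c a -> notin_I c' a -> c = c'].

(* kQ/I is spanned by the classes of finitely many elements of kQ. *)
Definition quotient_findim : Prop :=
  exists s : seq kQ, forall x : kQ, exists c : nat -> k,
    rel_ideal (x - \sum_(i < size s) c i *: s`_i).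

Definition gentle : Prop := locally_gentle /\ quotient_findim.

Definition maximal_path p : Prop :=
  [/\ ~ rel_ideal (pbasis k p),
      forall a, rel_ideal (pbasis k p * pbasis k (arrow_path a)) &
      forall a, rel_ideal (pbasis k (arrow_path a) * pbasis k p)].

Definition path_permutation n p (alpha : 'S_n) : Prop :=
  let v (i : 'I_n) := nth (psource p) (vertices p) i in
  [/\ size (vertices p) = n,
      forall i j, j != i -> v j = v i -> alpha i = j &
      forall i, (forall j, j != i -> v j <> v i) -> alpha i = i].

(* kQ/I is a gentle algebra with one maximal path, and alpha is the
   quasi-diagram associated to it. *)
Definition gentle_with_diagram n (alpha : 'S_n) : Prop :=
  gentle /\ exists2 p, unique maximal_path p & path_permutation p alpha.

End BoundQuivers.

Definition opposite_quiver (Q : quiver) : quiver :=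
  @Quiver (vertex Q) (arrow Q) (@target Q) (@source Q).

Section KoszulDual.
Context (B : bound_quiver).

(* The opposite of the path ab of Q is the path ba of the opposite quiver. *)
Definition dual_rel : rel (arrow (opposite_quiver B)) :=
  fun b a : arrow B => (target a == source b) && ~~ zero_rel a b.

Lemma dual_rel_comp (b a : arrow (opposite_quiver B)) :
  dual_rel b a -> target b = source a.
Proof. by case/andP=> /eqP. Qed.

Definition koszul_dual : bound_quiver := BoundQuiver dual_rel_comp.

End KoszulDual.

(* beta is the Koszul dual quasi-diagram of alpha. *)
Definition koszul_dual_diagram (k : fieldType) n (alpha beta : 'S_n) : Prop :=
  exists B : bound_quiver,
    gentle_with_diagram k B alpha /\ gentle_with_diagram k (koszul_dual B) beta.

Section QuasiDiagrams.
Context (n : nat).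
Local Open Scope group_scope.
Implicit Types (alpha : 'S_n) (E : {set 'S_n}).

Definition quasi_diagrams : {set 'S_n} := [set alpha | alpha * alpha == 1].

Definition zeta : 'S_n := perm (@ordS_inj n).

Definition expz (s : 'S_n) (l : int) : 'S_n :=
  match l with Posz m => s ^+ m | Negz m => s ^- m.+1 end.

Definition chord_diagrams : {set 'S_n} :=
  [set alpha in quasi_diagrams | [forall i, alpha i != i]].

(* Products in 'S_n are composed from left to right: the permutation written
   zeta_n alpha with right-to-left composition is alpha * zeta here, and
   likewise for the conjugates in [closed_rotation]. *)
Definition maximal_diagrams : {set 'S_n} :=
  [set alpha in quasi_diagrams | #|porbits (alpha * zeta)| == 1%N].

Definition maximal_chord_diagrams : {set 'S_n} :=
  chord_diagrams :&: maximal_diagrams.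

Definition closed_rotation E : Prop :=
  forall alpha (l : int), alpha \in E ->
    expz zeta (- l)%R * alpha * expz zeta l \in E.

Definition closed_koszul (k : fieldType) E : Prop :=
  forall alpha, alpha \in E ->
    exists2 beta, koszul_dual_diagram k alpha beta & beta \in E.

End QuasiDiagrams.

(* Main.v *)
Require Import Defs.
From mathcomp Require Import all_boot all_order all_fingroup all_algebra.
From mathcomp Require Import finmap monalg.

(** Let [p] be the only maximal path of a gentle algebra with diagram [alpha].
    By finite dimension the nonzero paths have bounded length, so [p] is the
    longest one and contains every arrow; by pumping it contains each arrow only
    once; so the arrows are numbered
    by [p], and a relation [a b] holds exactly when the start of [b] is the
    position matched by [alpha], without being equal, to the end of [a]
    ([zero_rel_step], [step_zero_rel]). The nonzero paths of the Koszul dual are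
    the sequences of arrows with successive relations, read backwards. Thus, if
    the dual has a unique maximal path too, that path orders the ends of all the
    arrows in a single chain in which each element is the image of the preceding
    one by [tau = alpha * zeta n], never starting from a fixed point of [alpha]
    except possibly at its end ([dual_spanning_chain]). The chain misses only the
    start of [p].

    A set of diagrams closed under rotations and Koszul duals therefore gives,
    for each of its members [alpha], such a chain missing any prescribed position
    ([spanning_chainJ]). A fixed point of [alpha] would force [tau] to be an
    [n]-cycle at one base point and to have a fixed point at another
    ([spanning_chains_fixfree]). So [alpha] is a chord diagram; then the chain
    closes up through its base point, [tau] is an [n]-cycle, and [alpha] is
    maximal. Finally [alpha] and [zeta n] have product an [n]-cycle, and
    comparing signatures gives [4 %| n] ([maximal_chord_size]). *)

Set Implicit Arguments.
Unset Strict Implicit.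
Unset Printing Implicit Defensive.

Import GRing.Theory.

(** * Chains in quasi-diagrams *)

Section Chains.
Context {n : nat}.
Implicit Types (alpha g : 'S_n) (b w x : 'I_n) (ws : seq 'I_n).

(** With products written from left to right, [alpha * zeta n] sends [w] to
    [zeta n (alpha w)]. If positions are the vertices of the maximal path and
    [w] is the end of an arrow, then the arrow starting at position [alpha w]
    ends at [zeta n (alpha w)]; for [alpha w != w] the composite of the two
    arrows is a relation. So a step joins consecutive arrows of a nonzero path
    of the Koszul dual. *)
Definition chain_step alpha : rel 'I_n :=
  fun w w' => ((alpha * zeta n)%g w == w') && (alpha w != w).

(** The trace on the positions of a maximal path of the Koszul dual that
    contains every arrow: the chain [w :: ws] lists the ends of the arrows, and
    [b] is the one position where no arrow ends. The last condition says why the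
    chain cannot be prolonged: either no arrow starts at [alpha (last w ws)],
    because that position precedes [b] cyclically, or [last w ws] is a fixed
    point of [alpha]. *)
Definition spanning_chain alpha b w ws : Prop :=
  [/\ uniq (b :: w :: ws), size (b :: w :: ws) = n, path (chain_step alpha) w ws
    & (alpha * zeta n)%g (last w ws) = b \/ alpha (last w ws) = last w ws].

Lemma spanning_chain_mem alpha b w ws : spanning_chain alpha b w ws ->
  forall x, x \in b :: w :: ws.
Proof.
case=> uW sW _ _ x; have: #|b :: w :: ws| == #|'I_n|.
  by rewrite (card_uniqP uW) sW card_ord.
by move/eqP/subset_cardP => /(_ (subset_predT _)) ->.
Qed.

(** Rotating a diagram amounts to keeping it and moving the base point [b]:
    this is how closure under rotations gives a spanning chain of the same
    diagram at every base point. *)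
Lemma spanning_chainJ alpha g b w ws : commute g (zeta n) ->
  spanning_chain (alpha ^ g^-1) b w ws ->
  spanning_chain alpha (g b) (g w) (map g ws).
Proof.
move=> gz [uW sW pW lW].
have ag x : g ((alpha ^ g^-1)%g x) = alpha (g x).
  by rewrite conjgE !permM invgK permKV.
have zg x : g (zeta n x) = zeta n (g x) by rewrite -!permM gz.
have tg x : g (((alpha ^ g^-1) * zeta n)%g x) = (alpha * zeta n)%g (g x).
  by rewrite !(permM _ (zeta n)) zg ag.
split.
- by rewrite -!map_cons map_inj_uniq //; apply: perm_inj.
- by move: sW; rewrite /= size_map.
- rewrite path_map; apply: sub_path pW => x y /andP[/eqP <- nx].
  by rewrite /chain_step /= tg eqxx -ag (inj_eq perm_inj).
- rewrite last_map; case: lW => lW; first by left; rewrite -tg lW.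
  by right; rewrite -ag lW.
Qed.

(** A step never leaves a fixed point, so a fixed point can only be the end of
    the chain. *)
Lemma spanning_chain_fixed alpha b w ws x : spanning_chain alpha b w ws ->
  alpha x = x -> x != b -> last w ws = x.
Proof.
move=> W ax xb; have := spanning_chain_mem W x; case: W => _ _ pW _.
rewrite inE (negPf xb) /= => xW; case/splitPl: ws / xW pW => ws1 ws2 lx.
rewrite last_cat lx cat_path lx => /andP[_].
by case: ws2 => //= y ws2; rewrite /chain_step ax eqxx andbF.
Qed.

Lemma fpath_porbits (s : 'S_n) x xs : fpath s x xs ->
  (forall y, y \in x :: xs) -> #|porbits s| = 1%N.
Proof.
move=> pX mX; suff ->: porbits s = [set porbit s x] by rewrite cards1.
apply/setP=> P; rewrite inE; apply/imsetP/eqP => [[y _ ->]|->]; last by exists x.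
apply/eqP; rewrite eq_porbit_mem.
have [m mE] := fpathP pX; have := mX y; rewrite mE -trajectS.
by case/trajectP=> i _ ->; rewrite -permX mem_porbit.
Qed.

Lemma spanning_chain_cyclic alpha b w ws : spanning_chain alpha b w ws ->
  (alpha * zeta n)%g (last w ws) = b -> #|porbits (alpha * zeta n)%g| = 1%N.
Proof.
move=> W lb; apply: (@fpath_porbits _ w (rcons ws b)).
  case: W => _ _ pW _; rewrite rcons_path /= lb eqxx andbT.
  by apply: sub_path pW => x y /andP[].
move=> y; have := spanning_chain_mem W y.
by rewrite -rcons_cons mem_rcons.
Qed.

(** If the last image is not [b], it lies in the chain, which is then stable
    under the permutation; the only position left over is fixed. *)
Lemma spanning_chain_broken alpha b w ws : spanning_chain alpha b w ws ->
  (alpha * zeta n)%g (last w ws) != b -> (alpha * zeta n)%g b = b.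
Proof.
set t := (alpha * zeta n)%g => W lb; have mW := spanning_chain_mem W.
have [uW _ pW _] := W.
have tW x : x \in w :: ws -> t x \in w :: ws.
  move=> xW; case/splitPl: {-1}ws / xW (erefl ws) => ws1 [|y ws2] lx wsE.
    have := mW (t x); rewrite inE -lx.
    by move: lb; rewrite wsE cats0 => /negPf-> /=.
  move: pW; rewrite wsE cat_path lx /= => /and3P[_ /andP[/eqP-> _] _].
  by rewrite inE mem_cat inE eqxx !orbT.
have sW : map t (w :: ws) =i w :: ws.
  apply/(uniq_min_size _ _ _).2; rewrite ?size_map //.
    by rewrite map_inj_uniq; [case/andP: uW | apply: perm_inj].
  by move=> _ /mapP[x xW ->]; apply: tW.
have := mW (t b); rewrite inE -sW mem_map ?(andP uW).1 //; last exact: perm_inj.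
by case/andP: uW => /negPf-> _; rewrite orbF => /eqP.
Qed.

(** Let [x] be a fixed point. At the base point [zeta n x] the chain ends in [x]
    and returns to the base point, so [alpha * zeta n] is an [n]-cycle. At a base
    point other than [x] and [zeta n x], which exists as [n > 2], the chain also
    ends in [x] but does not return to the base point, so the base point is fixed
    by [alpha * zeta n]: a contradiction. *)
Lemma spanning_chains_fixfree alpha : 2 < n ->
  (forall b, exists w ws, spanning_chain alpha b w ws) ->
  forall x, alpha x != x.
Proof.
move=> n2 chains x; apply/eqP => ax.
have zx y : zeta n y != y.
  rewrite permE -val_eqE /=; case: (ltngtP y.+1 n) (ltn_ord y) => // [yn|yn] _.
    by rewrite modn_small ?gtn_eqF.
  by rewrite yn modnn ltn_eqF // -ltnS yn ltnW.
have lastx b w ws : x != b -> spanning_chain alpha b w ws -> last w ws = x.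
  by move=> xb W; apply: spanning_chain_fixed W ax xb.
have [w [ws W]] := chains (zeta n x).
have tx := lastx _ _ _ _ W; rewrite eq_sym zx in tx.
have t1 : #|porbits (alpha * zeta n)%g| == 1%N.
  by rewrite (spanning_chain_cyclic W) ?tx // permM ax.
have /card_gt0P[b] : 0 < #|~: [set x; zeta n x]|.
  by rewrite cardsCs setCK card_ord cards2 eq_sym zx subn_gt0.
rewrite !inE negb_or => /andP[bx bz].
have [v [vs V]] := chains b.
have lV : last v vs = x by apply: lastx V; rewrite eq_sym.
have tb : (alpha * zeta n)%g b = b.
  by apply: spanning_chain_broken V _; rewrite lV permM ax eq_sym.
have /eqP : (b : 'I_n) = x; last by rewrite (negPf bx).
have xb : x \in porbit (alpha * zeta n)%g b.
  case/cards1P: t1 => O tO.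
  by rewrite -eq_porbit_mem; apply/eqP; transitivity O; last symmetry;
    apply/set1P; rewrite -tO; apply: imset_f.
by case/porbitP: xb => i ->; elim: i => [|i IHi]; rewrite ?perm1 // expgSr permM -IHi tb.
Qed.

End Chains.

(** * Signatures *)

Lemma zetaX_ord0 m (i : 'I_m.+1) : (zeta m.+1 ^+ i)%g ord0 = i.
Proof.
apply: val_inj; rewrite permX; case: i => k /=.
elim: k => //= k IHk km.
by rewrite permE /= IHk ?modn_small // ltnW.
Qed.

Lemma porbits_zeta m : #|porbits (zeta m.+1)| = 1%N.
Proof.
suff P x : porbit (zeta m.+1) x = porbit (zeta m.+1) ord0.
  suff ->: porbits (zeta m.+1) = [set porbit (zeta m.+1) ord0] by rewrite cards1.
  by apply/setP=> A; rewrite inE; apply/imsetP/eqP => [[x _ ->]|->]; last exists ord0.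
by rewrite -[in LHS](zetaX_ord0 x) porbit_perm.
Qed.

Lemma card_porbits_involution (T : finType) (s : {perm T}) :
  (s * s = 1)%g -> (forall x, s x != x) -> #|T| = #|porbits s| * 2.
Proof.
move=> ss sx; rewrite -cardsT; apply: card_uniform_partition.
  move=> _ /imsetP[x _ ->]; suff ->: porbit s x = [set x; s x].
    by rewrite cards2 eq_sym sx.
  apply/setP=> y; rewrite !inE; apply/porbitP/orP => [[i ->]|].
    elim: i => [|i [] /eqP IHi]; first by rewrite perm1 eqxx; left.
      by right; rewrite expgSr permM IHi.
    by left; rewrite expgSr permM IHi -permM ss perm1.
  by case=> /eqP->; [exists 0 | exists 1]; rewrite ?perm1.
suff ->: porbits s = orbit 'P <[s]> @: [set: T].
  by apply: orbit_partition; apply/actsP=> ? _ ?; rewrite !inE.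
rewrite -porbitE; apply/setP=> A.
by apply/imsetP/imsetP=> -[x _ ->]; exists x; rewrite ?inE.
Qed.

(** Compare signatures in [alpha * zeta n]. A chord diagram has [n / 2] orbits,
    so [n] is even and [zeta n] is odd; the [n]-cycle [alpha * zeta n] is odd as
    well, so [alpha] is even, being a product of [n / 2] transpositions. *)
Lemma maximal_chord_size n (alpha : 'S_n) : 0 < n ->
  alpha \in maximal_chord_diagrams n -> exists g, n = 4 * g.
Proof.
case: n alpha => // m alpha _; rewrite !inE -andbA.
case/and4P=> /eqP aa /forallP ax _ /eqP t1.
move: (odd_permM alpha (zeta m.+1)) (card_porbits_involution aa ax).
rewrite /odd_perm /= t1 porbits_zeta card_ord; move: #|porbits alpha| => c pE mE.
move: pE; rewrite mE oddM andbF /=; case oc: (odd c) => //= _; exists c./2.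
by rewrite -{1}(odd_double_half c) oc add0n -muln2 -mulnA mulnC.
Qed.

(** * Nonzero paths and unique maximal paths *)

(** The successive pairs of arrows in nonzero paths: [follows] gathers
    composability and the absence of a relation, so that nonzero paths of
    positive length become sorted sequences of arrows. *)
Definition follows (B : bound_quiver) : rel (arrow B) :=
  fun a b => (target a == source b) && ~~ zero_rel a b.

Section Walks.
Context (k : fieldType) (B : bound_quiver).
Implicit Types (a b : arrow B) (s : seq (arrow B)) (p q r : qpath B).
Local Notation rel_ideal := (@rel_ideal k B).
Local Notation pb := (pbasis k).

Lemma sorted_follows p :
  sorted (@follows B) (parrows p) = nonzero_walk (parrows p).
Proof.
apply/idP/idP; first by apply: sub_sorted => a b /andP[].
case: p => -[v [|a s]] //=; rewrite /parrows /nonzero_walk /= => /andP[_].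
elim: s a => //= b s IHs a /andP[/eqP ab bs] /andP[nab nbs].
by rewrite /follows ab eqxx nab IHs.
Qed.

Lemma sorted_path_exists a s : sorted (@follows B) (a :: s) ->
  exists p, [/\ psource p = source a, parrows p = a :: s & nonzero_walk (parrows p)].
Proof.
move=> Fs; have ws : walk (source a) (a :: s).
  rewrite /= eqxx; elim: s a Fs => //= b s IHs a /andP[/andP[/eqP ab _] bs].
  by rewrite ab eqxx IHs.
pose p : qpath B := @QPath B (source a, a :: s) ws.
by exists p; rewrite -sorted_follows.
Qed.

Lemma pbasisM p q r : ptarget p = psource q ->
  psource r = psource p -> parrows r = parrows p ++ parrows q ->
  (pb p * pb q)%R = pb r.
Proof.
move=> pq rs ra; have [x xE xV] := pcompP pq.
rewrite -[LHS]/(pamul _ _) pamul_basis /pmul xE /=; congr pbasis.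
apply: val_inj; rewrite xV -rs -ra; exact/esym/surjective_pairing.
Qed.

Lemma pbasisM0 p q : ptarget p != psource q -> (pb p * pb q)%R = 0%R.
Proof. by move=> pq; rewrite -[LHS]/(pamul _ _) pamul_basis /pmul pcompN. Qed.

Lemma rel_ideal_two_sided : two_sided_ideal rel_ideal.
Proof.
split=> [J [] // | x y Ix Iy J iJ gJ | u x v Ix J iJ gJ].
  by have [_ + _] := iJ; apply; [apply: Ix | apply: Iy].
by have [_ _] := iJ; apply; apply: Ix.
Qed.

(** The ideal is monomial: a path lies in it exactly when one of its subpaths of
    length two is a generator. *)
Lemma rel_ideal_basis p : rel_ideal (pb p) <-> ~~ nonzero_walk (parrows p).
Proof.
split=> [Ip | nz].
  apply/negP => /(rel_ideal_coef0 Ip)/eqP.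
  by rewrite mcoeffUU oner_eq0.
have [x [y [a [b [pE zab]]]]] : exists x y a b,
    parrows p = x ++ [:: a; b] ++ y /\ zero_rel a b.
  case: (parrows p) nz => //= a s; elim: s a => //= b s IHs a.
  rewrite negb_and negbK => /orP[zab | /IHs[x [y [c [d [-> zcd]]]]]].
    by exists [::], s, a, b.
  by exists (a :: x), y, c, d.
have wp : walk (psource p) (parrows p) := valP p; rewrite pE walk_cat in wp.
case/andP: wp => wx; rewrite walk_cat => /andP[wab wy].
have [sa tab] : source a = last (psource p) [seq target i | i <- x] /\
    source b = target a.
  by move: wab => /= /and3P[/eqP-> /eqP].
pose px : qpath B := @QPath B (psource p, x) wx.
pose py : qpath B := @QPath B (target b, y) wy.
have [r rs ra] : exists2 r, psource r = psource px & parrows r = x ++ [:: a; b].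
  have wr : walk (psource p) (x ++ [:: a; b]) by rewrite walk_cat wx wab.
  by exists (@QPath B (psource p, x ++ [:: a; b]) wr).
have [c cs ca] : exists2 c, psource c = source a & parrows c = [:: a; b].
  have wc : walk (source a) [:: a; b] by rewrite /= tab !eqxx.
  by exists (@QPath B (source a, [:: a; b]) wc).
have abE : (pb (arrow_path a) * pb (arrow_path b))%R = pb c by apply: pbasisM.
have xE : (pb px * pb c)%R = pb r.
  by apply: pbasisM; rewrite ?ca // ptargetE cs sa.
have rE : (pb r * pb py)%R = pb p.
  apply: pbasisM; rewrite ?ra -?catA //.
  by rewrite ptargetE rs ra map_cat last_cat.
rewrite -rE -xE -abE; have [_ _ idealM] := rel_ideal_two_sided.
by apply: (idealM _ _ _ _) => //; apply/rel_ideal_path2.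
Qed.

(** Elements of the ideal have no coefficient on nonzero paths. Hence a path
    congruent to a combination of given elements occurs in the support of one of
    them, and finitely many spanning elements have finite supports. *)
Lemma finite_nonzero_paths : quotient_findim k B ->
  exists D : {fset qpath B}, forall p, nonzero_walk (parrows p) -> p \in D.
Proof.
case=> s sP; exists (\big[fsetU/fset0]_(x <- s) msupp x)%fset => p nzp.
have [c cP] := sP (pb p); have := rel_ideal_coef0 cP nzp.
apply: contra_eqT => pD; rewrite mcoeffB mcoeffUU raddf_sum big1 ?subr0 ?oner_eq0 //.
move=> i _; rewrite /= mcoeffZ mcoeff_outdom ?mulr0 //.
apply: contra pD; apply: fsubsetP; apply: bigfcup_sup => //; exact: mem_nth.
Qed.

Lemma maximal_pathE p : maximal_path k p <->
  [/\ nonzero_walk (parrows p),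
      forall a, ptarget p = source a -> ~~ nonzero_walk (rcons (parrows p) a) &
      forall a, target a = psource p -> ~~ nonzero_walk (a :: parrows p)].
Proof.
have ext_r a : ptarget p = source a -> exists2 r,
    (pb p * pb (arrow_path a))%R = pb r & parrows r = rcons (parrows p) a.
  move=> pa; have [r _ rV] := pcompP (pa : ptarget p = psource (arrow_path a)).
  exists r; first by apply: pbasisM; rewrite // /psource /parrows rV.
  by rewrite /parrows rV /= cats1.
have ext_l a : target a = psource p -> exists2 r,
    (pb (arrow_path a) * pb p)%R = pb r & parrows r = a :: parrows p.
  move=> ap; have [r _ rV] := pcompP (ap : ptarget (arrow_path a) = psource p).
  exists r; first by apply: pbasisM; rewrite // /psource /parrows rV.
  by rewrite /parrows rV.
have I0 : rel_ideal 0%R by have [] := rel_ideal_two_sided.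
split=> [[nIp Ir Il] | [nzp zr zl]]; split.
- by apply/negP => /negP/rel_ideal_basis.
- move=> a /ext_r[r rE <-]; apply/rel_ideal_basis; rewrite -rE; exact: Ir.
- move=> a /ext_l[r rE <-]; apply/rel_ideal_basis; rewrite -rE; exact: Il.
- by move/rel_ideal_basis; rewrite nzp.
- move=> a; have [pa | npa] := eqVneq (ptarget p) (source a); last by rewrite pbasisM0.
  by have [r -> rE] := ext_r _ pa; apply/rel_ideal_basis; rewrite rE zr.
- move=> a; have [ap | nap] := eqVneq (target a) (psource p); last by rewrite pbasisM0.
  by have [r -> rE] := ext_l _ ap; apply/rel_ideal_basis; rewrite rE zl.
Qed.

(** A longest nonzero path with a property stable under prolongation on either
    side is a maximal path. *)
Lemma longest_maximal_path (P : pred (seq (arrow B))) p0 :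
  quotient_findim k B ->
  (forall s a, P s -> P (rcons s a)) -> (forall s a, P s -> P (a :: s)) ->
  nonzero_walk (parrows p0) -> P (parrows p0) ->
  exists q, [/\ maximal_path k q, P (parrows q) & forall r,
    nonzero_walk (parrows r) -> P (parrows r) ->
    size (parrows r) <= size (parrows q)].
Proof.
move=> /finite_nonzero_paths[D DP] Pr Pl nz0 P0.
pose len (p : D) := size (parrows (val p)).
pose good (p : D) := nonzero_walk (parrows (val p)) && P (parrows (val p)).
have g0 : good [` DP _ nz0]%fset by rewrite /good nz0.
case: (arg_maxnP len g0) => -[q qD] /= /andP[/= nzq Pq] qmax.
have long r : nonzero_walk (parrows r) -> P (parrows r) ->
    size (parrows r) <= size (parrows q).
  by move=> nzr Pr'; apply: (qmax [` DP _ nzr]%fset); rewrite /good /= nzr.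
exists q; split=> //; apply/maximal_pathE; split=> // a qa; apply/negP=> nza.
- have [r _ rV] := pcompP (qa : ptarget q = psource (arrow_path a)).
  have rE : parrows r = rcons (parrows q) a by rewrite /parrows rV /= cats1.
  by have := long r; rewrite rE size_rcons ltnn => -/(_ nza (Pr _ _ Pq)).
- have [r _ rV] := pcompP (qa : ptarget (arrow_path a) = psource q).
  have rE : parrows r = a :: parrows q by rewrite /parrows rV.
  by have := long r; rewrite rE /= ltnn => -/(_ nza (Pl _ _ Pq)).
Qed.

Section UniqueMaximalPath.
Context (p : qpath B).
Hypotheses (fdB : quotient_findim k B) (p1 : unique (maximal_path k (B := B)) p).

Lemma unique_maximal_path_mem a : a \in parrows p.
Proof.
have [||//||q [qmax aq _]] :=
    @longest_maximal_path (fun s => a \in s) (arrow_path a) fdB.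
- by move=> s b; rewrite mem_rcons inE orbC => ->.
- by move=> s b; rewrite inE orbC => ->.
- by rewrite inE.
by rewrite (p1.2 _ qmax).
Qed.

Lemma unique_maximal_path_longest s :
  sorted (@follows B) s -> size s <= size (parrows p).
Proof.
case: s => // a s /sorted_path_exists[r [_ rE nzr]].
have [nzp _ _] := (maximal_pathE p).1 p1.1.
have [//|//|//|//|q [qmax _ long]] := @longest_maximal_path predT p fdB.
by rewrite (p1.2 _ qmax) -rE long.
Qed.

Lemma unique_maximal_path_sorted : sorted (@follows B) (parrows p).
Proof. by rewrite sorted_follows; have [] := (maximal_pathE p).1 p1.1. Qed.

Lemma unique_maximal_path_rcons a : ~~ sorted (@follows B) (rcons (parrows p) a).
Proof.
by apply/negP => /unique_maximal_path_longest; rewrite size_rcons ltnn.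
Qed.

Lemma unique_maximal_path_cons a : ~~ sorted (@follows B) (a :: parrows p).
Proof. by apply/negP => /unique_maximal_path_longest; rewrite /= ltnn. Qed.

(** Pumping: going twice around the part of the path between two occurrences of
    an arrow would give a longer nonzero path. *)
Lemma unique_maximal_path_uniq : uniq (parrows p).
Proof.
have dup s : ~~ uniq s -> exists (a : arrow B) x y z, s = x ++ a :: y ++ a :: z.
  elim: s => //= a s IHs; rewrite negb_and negbK => /orP[as_ | /IHs].
    by case/splitPr: as_ => y z; exists a, [::], y, z.
  by case=> b [x [y [z ->]]]; exists b, (a :: x), y, z.
apply: contraT => /dup[a [x [y [z pE]]]].
have := unique_maximal_path_sorted; rewrite pE sorted_cat_cons cat_path /=.
case/and4P=> xa ay ya az.
have : sorted (@follows B) (x ++ a :: y ++ a :: y ++ a :: z).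
  by rewrite sorted_cat_cons cat_path /= cat_path /= xa ay ya az.
move/unique_maximal_path_longest; rewrite pE !size_cat /= !size_cat /= !size_cat /=.
by rewrite leq_add2l ltnS -[leqRHS]add0n -addSnnS addnS leq_add2r.
Qed.

End UniqueMaximalPath.
End Walks.

(** * The Koszul dual on the positions of the maximal path *)

Lemma follows_unique (k : fieldType) (B : bound_quiver) (a b c : arrow B) :
  locally_gentle k B -> follows a b -> follows a c -> b = c.
Proof.
case=> _ _ _ notin_uniq _ /andP[/eqP ab nab] /andP[/eqP ac nac].
apply: (notin_uniq a); split=> //.
  by move/(rel_ideal_path2 k ab); rewrite (negPf nab).
by move/(rel_ideal_path2 k ac); rewrite (negPf nac).
Qed.

(** Nonzero compositions in the Koszul dual are the relations of [B], read
    backwards. *)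
Lemma follows_dual (B : bound_quiver) (a b : arrow B) :
  @follows (koszul_dual B) b a = zero_rel a b.
Proof.
rewrite /follows /= /dual_rel; apply/andP/idP => [[/eqP -> ]|zab].
  by rewrite eqxx negbK.
by rewrite (zero_rel_comp zab) eqxx negbK.
Qed.

Lemma nth_walk_source (Q : quiver) (d v : vertex Q) (a : arrow Q) s i :
  walk v s -> i < size s ->
  nth d (v :: [seq target b | b <- s]) i = source (nth a s i).
Proof.
elim: s v i => //= b s IHs v [|i] /andP[/eqP bv bs]; first by rewrite -bv.
exact: IHs.
Qed.

Section DiagramOfPath.
Context (k : fieldType) (n : nat) (alpha : 'S_n.+1) (B : bound_quiver) (p : qpath B).
Hypotheses (gB : gentle k B) (p1 : unique (maximal_path k (B := B)) p)
  (pA : path_permutation p alpha).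
Implicit Types a b : arrow B.
Local Notation s := (parrows p).

(** The positions on [p] where an arrow of [B] starts and ends; they are
    meaningful because [p] runs through every arrow exactly once. *)
Definition src_pos a : 'I_n.+1 := inord (index a s).
Definition tgt_pos a : 'I_n.+1 := inord (index a s).+1.

Let vtx (i : 'I_n.+1) := nth (psource p) (vertices p) i.

Let size_s : size s = n.
Proof. by case: pA; rewrite /vertices /= size_map => -[]. Qed.

Let mem_s a : a \in s. Proof. exact: unique_maximal_path_mem gB.2 p1 a. Qed.

Lemma index_ltn a : index a s < n.
Proof. by have := index_mem a s; rewrite mem_s size_s. Qed.

Lemma val_src_pos a : src_pos a = index a s :> nat.
Proof. by rewrite inordK // ltnS ltnW // index_ltn. Qed.

Lemma val_tgt_pos a : tgt_pos a = (index a s).+1 :> nat.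
Proof. by rewrite inordK // ltnS index_ltn. Qed.

Lemma tgt_pos_inj : injective tgt_pos.
Proof.
move=> a b /(congr1 val) /=; rewrite !val_tgt_pos => -[ab].
by rewrite -(nth_index a (mem_s a)) ab nth_index.
Qed.

Lemma zeta_src_pos a : zeta n.+1 (src_pos a) = tgt_pos a.
Proof.
by apply: val_inj; rewrite permE /= val_src_pos val_tgt_pos modn_small // ltnS index_ltn.
Qed.

Lemma vertex_src_pos a : vtx (src_pos a) = source a.
Proof.
rewrite /vtx val_src_pos /vertices (nth_walk_source _ a) ?nth_index ?size_s ?index_ltn //.
exact: valP p.
Qed.

Lemma vertex_tgt_pos a : vtx (tgt_pos a) = target a.
Proof.
by rewrite /vtx val_tgt_pos /= (nth_map a) ?nth_index // size_s index_ltn.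
Qed.

Lemma src_pos_surj (i : 'I_n.+1) : i != n :> nat -> exists a, src_pos a = i.
Proof.
move=> ni; have i_n : i < n by rewrite ltn_neqAle ni -ltnS ltn_ord.
have [a0 _] : exists a, a \in s.
  have : 0 < size s by rewrite size_s (leq_ltn_trans _ i_n).
  by case: s => // a s' _; exists a; rewrite mem_head.
exists (nth a0 s i); apply: val_inj; rewrite /= val_src_pos index_uniq ?size_s //.
exact: unique_maximal_path_uniq gB.2 p1.
Qed.

Lemma follows_next a b : src_pos b = tgt_pos a -> follows a b.
Proof.
move/(congr1 val); rewrite /= val_src_pos val_tgt_pos => ba.
have := unique_maximal_path_sorted p1 => /(sortedP a)/(_ (index a s)).
by rewrite -ba index_mem mem_s !nth_index //; apply.
Qed.

(** Nonzero compositions are the pieces of length two of [p]. If [a] is not the last arrow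
    of [p], this is the uniqueness of the nonzero continuation of [a] in a gentle
    algebra; if [a] is the last arrow, a continuation would prolong [p]. *)
Lemma follows_nextE a b : follows a b -> src_pos b = tgt_pos a.
Proof.
move=> ab; have [/val_inj a_last | a_last] := eqVneq (val (tgt_pos a)) (val (@ord_max n)).
  case/negP: (unique_maximal_path_rcons gB.2 p1 b).
  have := unique_maximal_path_sorted p1.
  (* Here [a] is the last arrow of [p], so [b] can be appended to [p]. *)
  have := nth_last a s; rewrite size_s.
  have := congr1 val a_last; rewrite /= val_tgt_pos => <- /=; rewrite nth_index //.
  by case: s => [|c s'] //= aE cs; rewrite rcons_path cs -aE.
have [c cE] := src_pos_surj a_last.
by rewrite -cE (follows_unique gB.1 ab (follows_next cE)).
Qed.

Lemma diagram_vertex i : vtx (alpha i) = vtx i.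
Proof.
case: pA => _ pA1 pA2.
have [j /andP[ji /eqP vji] | no] := pickP (fun j => (j != i) && (vtx j == vtx i)).
  by rewrite (pA1 i j).
by rewrite pA2 // => j ji vji; have := no j; rewrite ji /vtx vji eqxx.
Qed.

Lemma zero_rel_step a b : zero_rel a b -> chain_step alpha (tgt_pos a) (tgt_pos b).
Proof.
move=> zab; have ba : src_pos b != tgt_pos a.
  by apply/eqP => /follows_next/andP[_]; rewrite zab.
have -> : chain_step alpha (tgt_pos a) =1
    (fun w => (zeta n.+1 (src_pos b) == w) && (src_pos b != tgt_pos a)).
  case: pA => _ pA1 _ w; rewrite /chain_step permM (pA1 _ (src_pos b)) //.
  by rewrite -/(vtx _) -/(vtx _) vertex_src_pos vertex_tgt_pos (zero_rel_comp zab).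
by rewrite zeta_src_pos eqxx.
Qed.

Lemma step_zero_rel a b : alpha (tgt_pos a) = src_pos b -> src_pos b != tgt_pos a ->
  zero_rel a b.
Proof.
move=> ab; apply: contraNT => nab; apply/eqP/follows_nextE.
rewrite /follows nab andbT; apply/eqP.
by rewrite -vertex_src_pos -ab diagram_vertex vertex_tgt_pos.
Qed.

(** The maximal path of the Koszul dual runs through all arrows once; read
    backwards, it gives a spanning chain based at the start of [p], where no
    arrow of [p] ends. *)
Lemma dual_spanning_chain (q : qpath (koszul_dual B)) : 0 < n ->
  quotient_findim k (koszul_dual B) ->
  unique (maximal_path k (B := koszul_dual B)) q ->
  exists w ws, spanning_chain alpha ord0 w ws.
Proof.
move=> n0 fdd q1; pose d : seq (arrow B) := parrows q.
have mem_d (a : arrow B) : a \in d := unique_maximal_path_mem fdd q1 a.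
have uniq_d : uniq d := unique_maximal_path_uniq fdd q1.
have d_sorted : sorted (@zero_rel B) (rev d).
  rewrite rev_sorted; have := unique_maximal_path_sorted q1.
  by apply: sub_sorted => b a; rewrite follows_dual.
have size_d : size (rev d) = n.
  rewrite -{1}size_s size_rev; apply/perm_size/uniq_perm => // [|a].
    exact: unique_maximal_path_uniq gB.2 p1.
  by rewrite mem_s mem_d.
case dE: (rev d) => [|c t]; first by rewrite -size_d dE in n0.
rewrite dE in d_sorted size_d.
exists (tgt_pos c), [seq tgt_pos a | a <- t]; split.
- rewrite -map_cons cons_uniq map_inj_uniq ?dE -?dE ?rev_uniq ?uniq_d ?andbT;
    last exact: tgt_pos_inj.
  by apply/mapP => -[a _ /(congr1 val)]; rewrite /= val_tgt_pos.
- by rewrite -map_cons /= size_map -size_d.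
- by rewrite path_map; apply: sub_path d_sorted => a b /zero_rel_step.
rewrite last_map; set z := last c t; set i := alpha _.
have [iz | iz] := eqVneq i (tgt_pos z); [by right | left].
rewrite permM -/i; have [i_n | i_n] := eqVneq (val i) n.
  by apply: val_inj; rewrite permE /= i_n modnn.
have [b bi] := src_pos_surj i_n.
(* Otherwise the arrow [b] starting at position [i] forms a relation [z b]
   with the last arrow [z] of the chain, so [b] prolongs the path [q] on the left. *)
case/negP: (unique_maximal_path_cons fdd q1 (b : arrow (koszul_dual B))).
have dE' : parrows q = z :: rev (belast c t).
  by rewrite -[LHS](revK d) dE lastI rev_rcons.
have := unique_maximal_path_sorted q1; rewrite dE' /= => ->.
by rewrite andbT follows_dual step_zero_rel ?bi.
Qed.

End DiagramOfPath.

(** * Diagrams closed under rotations and Koszul duals *)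

Theorem proposition6p6 (k : closedFieldType) (hk : ([pchar k])%R =i pred0)
    (n : nat) (hn : 3 <= n) (E : {set 'S_n}) (E0 : E != set0)
    (ED : E \subset quasi_diagrams n)
    (Erot : closed_rotation E) (Ekos : closed_koszul k E) :
  exists g : nat, n = 4 * g /\ E \subset maximal_chord_diagrams n.
Proof.
suff EM : E \subset maximal_chord_diagrams n.
  have [alpha /(subsetP EM) aM] := set0Pn _ E0.
  have [g nE] := maximal_chord_size (ltnW (ltnW hn)) aM.
  by exists g.
clear E0; case: n => [|n] // in hn E ED Erot Ekos *.
have chain0 alpha : alpha \in E -> exists w ws, spanning_chain alpha ord0 w ws.
  case/Ekos=> beta [B [[gB [p p1 pA]] [[_ fdd] [q q1 _]]]] _.
  exact: dual_spanning_chain gB p1 pA q (ltnW hn) fdd q1.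
apply/subsetP=> alpha aE.
have chains b : exists w ws, spanning_chain alpha b w ws.
  (* The base point 0 of this conjugate corresponds to the position [b] of [alpha],
     the image of 0 under [zeta ^+ b]. *)
  have := Erot alpha (- Posz b)%R aE; rewrite GRing.opprK.
  have -> : expz (zeta n.+1) (- Posz b)%R = (zeta n.+1 ^- b)%g.
    by case: (val b) => // ; rewrite expg0 invg1.
  rewrite /= -{1}[(zeta _ ^+ b)%g]invgK -mulgA -conjgE.
  case/chain0 => w [ws W]; rewrite -(zetaX_ord0 b).
  exists ((zeta n.+1 ^+ b)%g w), [seq (zeta n.+1 ^+ b)%g x | x <- ws].
  by apply: spanning_chainJ W; apply/commute_sym/commuteX.
have afree := spanning_chains_fixfree hn chains.
have [w [ws W]] := chains ord0.
have := subsetP ED _ aE; rewrite !inE => -> /=.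
apply/andP; split; first exact/forallP.
rewrite (spanning_chain_cyclic W) //; case: W => _ _ _ [//|/eqP].
by rewrite (negPf (afree _)).
Qed.
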